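(* Let $(R,m,K)$ be a complete Noetherian local ring of prime characteristic $p>0$. 1) The test ideal $\tau(R)$ is a strong test ideal, i.e. $\tau(R)\,I^\ast=\tau(R)\,I$ for every ideal $I$ of $R$. 2) Assume in addition that $R$ is a Cohen–Macaulay domain. Then the parameter test module $\tau_{par}(\omega_R)$ has the strong test module property, i.e. $I^\ast\,\tau_{par}(\omega_R)=I\,\tau_{par}(\omega_R)$ for every ideal $I$ of $R$.
   Context: Let $(R,m,K)$ be a Noetherian local ring of prime characteristic $p>0$. $R^o$ denotes the complement in $R$ of the union of the minimal primes of $R$. For $e\ge 0$ and $q=p^e$, $R^e$ denotes $R$ viewed as an $R$-bimodule with the usual left structure and with right structure via the iterated Frobenius $r\mapsto r^{q}$; for an $R$-module $M$, $F^e(M):=R^e\otimes_R M$, an $R$-module via the left structure. Tight closure: for a submodule $N\subseteq M$ (no finiteness on $M$ is assumed), $N^{[q]}_M:=\mathrm{Im}(F^e(N)\to F^e(M))$, and $N^\ast_M$ is the set of $u\in M$ for which there is $c\in R^o$ with $c\otimes u\in N^{[q]}_M$ for all $e$ sufficiently large. For an ideal $I$, $I^\ast:=I^\ast_R$. Test ideal: $\tau(R):=\bigcap_M \mathrm{Ann}_R(0^\ast_M)$, where $M$ runs through all finitely generated $R$-modules. Parameter test module: for $R$ complete local Cohen–Macaulay of dimension $d$ with canonical module $\omega_R=\mathrm{Hom}_R(H^d_m(R),E_R(K))$ (where $E_R(K)$ is the injective hull of $K$), $\tau_{par}(\omega_R):=\mathrm{Ann}_{\omega_R}(0^\ast_{H^d_m(R)})$,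 the set of elements of $\omega_R$ that annihilate $0^\ast_{H^d_m(R)}$ under the evaluation pairing $\omega_R\times H^d_m(R)\to E_R(K)$. *)

(* Defs.v *)
From HB Require Import structures.
From mathcomp Require Import all_boot all_order all_algebra.
From mathcomp Require Import generic_quotient ring_quotient.
From mathcomp Require Import boolp classical_sets functions.
From mathcomp Require Import finmap monalg.

Set Implicit Arguments.
Unset Strict Implicit.
Unset Printing Implicit Defensive.

Import GRing.Theory.
Local Open Scope ring_scope.
Local Open Scope quotient_scope.
Local Open Scope classical_set_scope.

Section Submodules.
Variables (R : comNzRingType) (M : lmodType R).

Definition submodule (N : set M) : Prop :=
  N 0 /\ forall (a : R) (x y : M), N x -> N y -> N (a *: x + y).

Definition gen (S : set M) : set M := smallest submodule S.

Definition finitely_generated (N : set M) : Prop :=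
  exists s : seq M, N = gen [set` s].

Definition smul (I : set R) (N : set M) : set M :=
  gen [set x | exists a y, [/\ I a, N y & x = a *: y]].

Lemma gen_submodule (S : set M) : submodule (gen S).
Proof.
split=> [N [[]//]|a x y Sx Sy N SN]; case: (SN) => -[_ +] _; apply.
- exact: Sx.
- exact: Sy.
Qed.

Definition gen_pred (S : set M) : {pred M} := fun x => `[< gen S x >].

Lemma gen_pred_closed (S : set M) : submod_closed (gen_pred S).
Proof.
have [S0 SD] := gen_submodule S.
split=> [|a x y /asboolP Sx /asboolP Sy]; apply/asboolP => //; exact: SD.
Qed.

HB.instance Definition _ (S : set M) :=
  GRing.isSubmodClosed.Build R M (gen_pred S) (gen_pred_closed S).

(* The submodule generated by S, as a module.  Taking generators instead of a
   submodule avoids carrying a closure proof: when S is itself a submodule,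
   gen S = S (smallest_id), so this is S.  The same applies to quotients. *)
Definition submod (S : set M) : Type := {x : M | gen_pred S x}.
HB.instance Definition _ (S : set M) := SubChoice.on (submod S).
HB.instance Definition _ (S : set M) :=
  [SubChoice_isSubLmodule of submod S by <:].

Section Quotient.
Variable S : set M.

Definition quotmod : Type := Quotient.quot (gen_pred S).
HB.instance Definition _ := EqQuotient.on quotmod.
HB.instance Definition _ := GRing.Zmodule.on quotmod.

Definition quot_proj (x : M) : quotmod := \pi_(Quotient.quot (gen_pred S)) x.

Lemma quot_projE x y : (quot_proj x = quot_proj y) <-> gen S (x - y).
Proof.
split=> [/eqmodP|Sxy]; first by rewrite /= /Quotient.equiv => /asboolP.
by apply/eqmodP; rewrite /= /Quotient.equiv; apply/asboolP.
Qed.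

Lemma quot_projD x y : quot_proj (x + y) = quot_proj x + quot_proj y.
Proof. exact: Quotient.pi_add. Qed.

Definition quot_scale (a : R) (x : quotmod) : quotmod :=
  quot_proj (a *: (repr x : M)).

Lemma quot_scaleE a x : quot_scale a (quot_proj x) = quot_proj (a *: x).
Proof.
apply/quot_projE; rewrite -scalerBr -[_ *: _]addr0.
have [S0 SD] := gen_submodule S; apply: SD => //; apply/quot_projE.
by rewrite /quot_proj reprK.
Qed.

Lemma quot_projP (x : quotmod) : exists y, x = quot_proj y.
Proof. by exists (repr x); rewrite /quot_proj reprK. Qed.

Lemma quot_scaleA a b x :
  quot_scale a (quot_scale b x) = quot_scale (a * b) x.
Proof. by have [y ->] := quot_projP x; rewrite !quot_scaleE scalerA. Qed.

Lemma quot_scale1 : left_id 1 quot_scale.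
Proof. by move=> x; have [y ->] := quot_projP x; rewrite quot_scaleE scale1r. Qed.

Lemma quot_scaleDr : right_distributive quot_scale +%R.
Proof.
move=> a x y; have [x' ->] := quot_projP x; have [y' ->] := quot_projP y.
by rewrite -quot_projD !quot_scaleE scalerDr quot_projD.
Qed.

Lemma quot_scaleDl x : {morph quot_scale^~ x : a b / a + b}.
Proof.
move=> a b; have [y ->] := quot_projP x.
by rewrite !quot_scaleE scalerDl quot_projD.
Qed.

HB.instance Definition _ := GRing.Zmodule_isLmodule.Build R quotmod
  quot_scaleA quot_scale1 quot_scaleDr quot_scaleDl.

End Quotient.
End Submodules.

Section Rings.
Variable R : comNzRingType.
Implicit Types I J P m : set R.

(* The unit ideal is an ideal, contrary to mathcomp's idealr_closed. *)
Definition ideal I : Prop := @submodule R R^o I.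

Definition prime_ideal P : Prop :=
  [/\ ideal P, P <> setT & forall a b, P (a * b) -> P a \/ P b].

Definition minimal_prime P : Prop :=
  prime_ideal P /\ forall Q, prime_ideal Q -> Q `<=` P -> Q = P.

Definition maximal_ideal I : Prop :=
  [/\ ideal I, I <> setT &
      forall J, ideal J -> I `<=` J -> J = I \/ J = setT].

Definition noetherian : Prop :=
  forall I, ideal I -> @finitely_generated R R^o I.

Definition local_ring m : Prop := forall I, maximal_ideal I <-> I = m.

Definition integral_domain : Prop := forall a b : R, a * b = 0 -> a = 0 \/ b = 0.

Definition Rcirc : set R := ~` (\bigcup_(P in minimal_prime) P).

Definition ideal_exp I n : set R := iter n (@smul R R^o I) setT.

(* R -> lim_n R/m^n is injective, and surjective. *)
Definition adically_complete m : Prop :=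
  \bigcap_n ideal_exp m n = [set 0] /\
  forall u : nat -> R, (forall n, ideal_exp m n (u n.+1 - u n)) ->
    exists l, forall n, ideal_exp m n (l - u n).

Definition prime_chain (n : nat) : Prop :=
  exists P : nat -> set R, (forall i, (i <= n)%N -> prime_ideal (P i)) /\
    forall i, (i < n)%N -> P i `<` P i.+1.

Definition krull_dim (d : nat) : Prop := prime_chain d /\ ~ prime_chain d.+1.

Definition seq_ideal (s : seq R) : set R := @gen R R^o [set` s].

Definition regular_sequence (s : seq R) : Prop :=
  seq_ideal s <> setT /\
  forall i, (i < size s)%N -> forall a,
    seq_ideal (take i s) (s`_i * a) -> seq_ideal (take i s) a.

Definition depth m (d : nat) : Prop :=
  (exists s, [/\ regular_sequence s, [set` s] `<=` m & size s = d]) /\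
  forall s, regular_sequence s -> [set` s] `<=` m -> (size s <= d)%N.

Definition cohen_macaulay_of_dim m (d : nat) : Prop :=
  krull_dim d /\ depth m d.

End Rings.
Arguments Rcirc R : clear implicits.

Section TightClosure.
Variables (p : nat) (R : comNzRingType).

Section Module.
Variable M : lmodType R.
Implicit Types (a b r : R) (x y : M).

(* The tensor product R^e (x)_R M as a left R-module: the free R-module on
   symbols [a, x], modulo additivity in a and in x, left R-linearity in a,
   and the balancing relation for the right action a.r = a r^(p^e). *)
Definition frob_relations (e : nat) : set {malg R[(R * M)%type]} :=
  [set z | exists a b x, z = << (a + b, x) >> - << (a, x) >> - << (b, x) >>]
  `|` [set z | exists a x y, z = << (a, x + y) >> - << (a, x) >> - << (a, y) >>]
  `|` [set z | exists r a x, z = << (r * a, x) >> - r *: << (a, x) >>]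
  `|` [set z | exists r a x,
         z = << (a * r ^+ (p ^ e), x) >> - << (a, r *: x) >>].

Definition frobF (e : nat) : lmodType R := quotmod (frob_relations e).

Definition tens (e : nat) a x : frobF e :=
  quot_proj (frob_relations e) << (a, x) >>.

(* The image of F^e(N) in F^e(M): F^e(N) is generated by the a (x) x. *)
Definition frob_power (e : nat) (N : set M) : set (frobF e) :=
  gen [set z | exists a x, N x /\ z = tens e a x].

Definition tight_closure (N : set M) : set M :=
  [set u | exists2 c, Rcirc R c &
     exists e0, forall e, (e0 <= e)%N -> frob_power N (tens e c u)].

End Module.

Definition test_ideal : set R :=
  [set r | forall M : lmodType R, finitely_generated [set: M] ->
     forall u, @tight_closure M [set 0] u -> r *: u = 0].

End TightClosure.
Arguments test_ideal p R : clear implicits.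

Section Homological.
Variable R : comNzRingType.

Definition injective_module (E : lmodType R) : Prop :=
  forall (A B : lmodType R) (f : {linear A -> B}) (g : {linear A -> E}),
    injective f -> exists h : {linear B -> E}, forall a, h (f a) = g a.

Record injective_hull (M : lmodType R) := InjectiveHull {
  hull_module :> lmodType R;
  hull_map : {linear M -> hull_module};
  hull_map_inj : injective hull_map;
  hull_injective : injective_module hull_module;
  hull_essential : forall N : set hull_module, submodule N ->
    N `&` range hull_map `<=` [set 0] -> N = [set 0] }.

Record injective_resolution (M : lmodType R) := InjectiveResolution {
  res_module :> nat -> lmodType R;
  res_aug : {linear M -> res_module 0};
  res_diff : forall n, {linear res_module n -> res_module n.+1};
  res_injective : forall n, injective_module (res_module n);
  res_aug_inj : injective res_aug;
  res_exact0 : [set x | res_diff 0 x = 0] = range res_aug;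
  res_exactS : forall n,
    [set x | res_diff n.+1 x = 0] = range (res_diff n) }.

Definition torsion (m : set R) (M : lmodType R) : set M :=
  [set x | exists n, forall a, ideal_exp m n a -> a *: x = 0].

Section LocalCohomology.
Variables (m : set R) (M : lmodType R) (I : injective_resolution M).

Definition cocycles (n : nat) : set (I n) :=
  [set x | torsion m x /\ res_diff I n x = 0].

Definition coboundaries (n : nat) : set (I n) :=
  match n with
  | 0%N => [set 0]
  | n'.+1 => [set res_diff I n' x | x in @torsion m (I n')]
  end.

(* The right derived functors of the m-torsion functor. *)
Definition local_cohomology (n : nat) : lmodType R :=
  quotmod [set x : submod (@cocycles n) | coboundaries (val x)].

End LocalCohomology.

Definition residue_field (m : set R) : lmodType R := @quotmod R R^o m.

(* Hom_R(H, E), as a submodule of the module of all functions H -> E. *)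
Definition hom_module (H E : lmodType R) : lmodType R :=
  submod [set f : H -> E | linear f].

Definition hom_eval (H E : lmodType R) (f : hom_module H E) : H -> E := val f.

Definition parameter_test_module (p : nat) (H E : lmodType R) :
    set (hom_module H E) :=
  [set f | forall z, @tight_closure p R H [set 0] z -> hom_eval f z = 0].

End Homological.

(* Main.v *)
(* Part 1.  Let a be in tau(R), x in I* and I = (y_1, ..., y_k).  By Krull's
   intersection theorem it suffices that a x lies in tau(R) I + m^n for every n.
   The annihilators Ann u, for u in 0*_M with M finitely generated, form a
   directed family with intersection tau(R), so by Chevalley's theorem R being
   complete gives one (M, u) with Ann u contained in tau(R) + m^n.  In the
   finitely generated module P = (R + M^k) / <(y_i, - u e_i)> every y_i . 1 is
   the image of u e_i, so I . 1 is contained in 0*_P, hence x . 1 is in 0*_P and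
   a x . 1 = 0.  Thus a x = sum_i b_i y_i with all b_i in Ann u.  This argument
   takes the place of Matlis duality, so no injective hull is constructed.

   Part 2.  Put N = 0*_H, let t be in tau_par and x in I*.  Then x z is in N
   whenever I z is contained in N, so x t vanishes on the kernel of
   H -> (H/N)^k, z |-> (y_i z)_i.  As E is injective, x t extends along this map
   to (H/N)^k, that is, x t = sum_i y_i t_i with all t_i killing N. *)
Require Import Defs.
From HB Require Import structures.
From mathcomp Require Import all_boot all_order all_algebra.
From mathcomp Require Import boolp classical_sets functions.
From mathcomp Require Import finmap monalg.

Set Implicit Arguments.
Unset Strict Implicit.
Unset Printing Implicit Defensive.

Import GRing.Theory.
Local Open Scope ring_scope.
Local Open Scope classical_set_scope.

(** * Linear maps, generated submodules and quotient modules *)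

Lemma linear_bundle (R : comNzRingType) (U V : lmodType R) (f : U -> V) :
  linear f -> exists g : {linear U -> V}, forall x, g x = f x.
Proof.
move=> fL; pose fM := GRing.isLinear.Build R U V *:%R f fL.
pose g : {linear U -> V} := HB.pack f fM.
by exists g.
Qed.

Section Submodules.
Variables (R : comNzRingType) (M : lmodType R).
Implicit Types (S N : set M) (x y : M).

Lemma submoduleD N x y : submodule N -> N x -> N y -> N (x + y).
Proof. by move=> [_ NP] Nx Ny; rewrite -[x]scale1r; exact: NP. Qed.

Lemma submoduleZ N a x : submodule N -> N x -> N (a *: x).
Proof. by move=> [N0 NP] Nx; rewrite -[_ *: _]addr0; exact: NP. Qed.

Lemma submoduleB N x y : submodule N -> N x -> N y -> N (x - y).
Proof.
move=> NM Nx Ny; rewrite -scaleN1r; apply: submoduleD => //.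
exact: submoduleZ.
Qed.

Lemma submodule_sum N (I : Type) (r : seq I) (P : pred I) (F : I -> M) :
  submodule N -> (forall i, P i -> N (F i)) -> N (\sum_(i <- r | P i) F i).
Proof.
move=> NM NF; elim/big_rec : _ => [|i x Pi Nx]; first exact: (proj1 NM).
by apply: submoduleD => //; exact: NF.
Qed.

Lemma gen_sub S N : submodule N -> S `<=` N -> gen S `<=` N.
Proof. exact: smallest_sub. Qed.

Lemma sub_gen S : S `<=` gen S.
Proof. exact: sub_gen_smallest. Qed.

Lemma gen_id N : submodule N -> gen N = N.
Proof. exact: smallest_id. Qed.

Lemma gen_mono S S' : S `<=` S' -> gen S `<=` gen S'.
Proof.
by move=> SS'; apply: gen_sub => [|x /SS']; [exact: gen_submodule|exact: sub_gen].
Qed.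

Lemma submodule_setU1 N y :
  submodule N -> submodule [set x | exists n c, N n /\ x = n + c *: y].
Proof.
move=> NM; split=> [|a _ _ [n [c [Nn ->]]] [n' [c' [Nn' ->]]]].
  by exists 0, 0; split; [exact: (proj1 NM)|rewrite scale0r addr0].
exists (a *: n + n'), (a * c + c'); split; first exact: (proj2 NM).
by rewrite scalerDr scalerA scalerDl addrACA.
Qed.

Lemma gen_setU1 S y x :
  gen (S `|` [set y]) x -> exists n c, gen S n /\ x = n + c *: y.
Proof.
have SM := gen_submodule S.
apply: (gen_sub (submodule_setU1 y SM)) => z [Sz|->].
  by exists z, 0; rewrite scale0r addr0; split => //; exact: sub_gen.
by exists 0, 1; rewrite scale1r add0r; split => //; exact: (proj1 SM).
Qed.

Lemma submodule_preimage (T : lmodType R) (f : {linear M -> T}) (N : set T) :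
  submodule N -> submodule [set x | N (f x)].
Proof.
move=> NM; split=> /= [|a x y Nx Ny]; first by rewrite linear0; case: NM.
by rewrite linearP; exact: (proj2 NM).
Qed.

Lemma submodule_ker (T : lmodType R) (f : {linear M -> T}) :
  submodule [set x | f x = 0].
Proof.
split=> /= [|a x y fx fy]; first exact: linear0.
by rewrite linearP fx fy scaler0 addr0.
Qed.

Lemma quot_lift (S : set M) (T : lmodType R) (f : {linear M -> T}) :
  (forall x, S x -> f x = 0) ->
  exists g : {linear quotmod S -> T}, forall x, g (quot_proj S x) = f x.
Proof.
move=> fS; pose g (x : quotmod S) := f (repr x).
have gE x : g (quot_proj S x) = f x.
  have : gen S (repr (quot_proj S x) - x).
    by apply/quot_projE; rewrite /quot_proj reprK.
  move=> /(gen_sub (submodule_ker f) fS) /eqP.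
  by rewrite linearB subr_eq0 => /eqP.
have gL : linear g.
  move=> a x y; have [x' ->] := quot_projP x; have [y' ->] := quot_projP y.
  have -> : a *: quot_proj S x' = quot_proj S (a *: x') by exact: quot_scaleE.
  by rewrite -quot_projD !gE linearP.
by have [h hE] := linear_bundle gL; exists h => x; rewrite hE gE.
Qed.

Lemma quot_proj_linear (S : set M) : linear (quot_proj S).
Proof. by move=> a x y; rewrite quot_projD; congr (_ + _); rewrite -quot_scaleE. Qed.

HB.instance Definition _ (S : set M) :=
  GRing.isLinear.Build R M (quotmod S) *:%R (quot_proj S) (@quot_proj_linear S).

Lemma quot_proj_eq0 (S : set M) x : quot_proj S x = 0 <-> gen S x.
Proof. by rewrite -[0](linear0 (quot_proj S)) quot_projE subr0. Qed.

End Submodules.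

(** * Linear maps out of free modules, and the Frobenius functors *)

Section MalgExt.
Variables (R : comNzRingType) (K : choiceType) (T : lmodType R) (h : K -> T).
Local Open Scope fset_scope.

(** The linear extension of [h] from the basis [K] to the free module; maps out of the tensor
    product are built from it. *)
Definition malg_ext (g : {malg R[K]}) : T := \sum_(k <- msupp g) g@_k *: h k.

Lemma malg_extE (d : {fset K}) (g : {malg R[K]}) :
  msupp g `<=` d -> malg_ext g = \sum_(k <- d) g@_k *: h k.
Proof.
move=> gd; apply: big_fset_incl => // k _ /mcoeff_outdom ->.
by rewrite scale0r.
Qed.

Lemma malg_ext_linear : linear malg_ext.
Proof.
(* All three supports are enlarged to one finite set, so that the sums can be compared termwise. *)
move=> a f g; pose d := msupp (a *: f + g) `|` (msupp f `|` msupp g).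
rewrite !(@malg_extE d) ?fsubsetUl //; last first.
- by rewrite /d fsubsetU // fsubsetUl orbT.
- by rewrite /d fsubsetU // fsubsetUr orbT.
rewrite scaler_sumr -big_split; apply: eq_bigr => k _ /=.
by rewrite mcoeffD mcoeffZ scalerDl scalerA.
Qed.

HB.instance Definition _ :=
  GRing.isLinear.Build R {malg R[K]} T *:%R malg_ext malg_ext_linear.

Lemma malg_extU k : malg_ext << k >> = h k.
Proof. by rewrite /malg_ext msuppU oner_eq0 big_seq_fset1 mcoeffUU scale1r. Qed.

End MalgExt.

Section Tensor.
Variables (p e : nat) (R : comNzRingType).

Section Rules.
Variable M : lmodType R.
Implicit Types (a b r : R) (x y : M).

Lemma tens_rel (z : {malg R[(R * M)%type]}) :
  @frob_relations p R M e z -> quot_proj (@frob_relations p R M e) z = 0.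
Proof. by move=> zR; apply/quot_proj_eq0; exact: sub_gen. Qed.

Lemma tensDl a b x : tens p e (a + b) x = tens p e a x + tens p e b x.
Proof.
apply/eqP; rewrite -subr_eq0 opprD addrA -!linearB; apply/eqP/tens_rel.
by do 3 left; exists a, b, x.
Qed.

Lemma tensDr a x y : tens p e a (x + y) = tens p e a x + tens p e a y.
Proof.
apply/eqP; rewrite -subr_eq0 opprD addrA -!linearB; apply/eqP/tens_rel.
by do 2 left; right; exists a, x, y.
Qed.

Lemma tensZl r a x : tens p e (r * a) x = r *: tens p e a x.
Proof.
apply/eqP; rewrite -subr_eq0 -linearZ -linearB; apply/eqP/tens_rel.
by left; right; exists r, a, x.
Qed.

Lemma tensZr r a x : tens p e a (r *: x) = tens p e (a * r ^+ (p ^ e)) x.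
Proof.
apply/eqP; rewrite eq_sym -subr_eq0 -linearB; apply/eqP/tens_rel.
by right; exists r, a, x.
Qed.

Lemma tens0r a : tens p e a (0 : M) = 0.
Proof. by apply: (addrI (tens p e a 0)); rewrite -tensDr !addr0. Qed.

End Rules.

(** The map $[a, x] \mapsto a \otimes f(x)$ on the free module respects the four families of
    relations, hence descends. *)
Lemma frob_functor (M T : lmodType R) (f : {linear M -> T}) :
  exists F : {linear frobF p M e -> frobF p T e},
    forall a x, F (tens p e a x) = tens p e a (f x).
Proof.
pose h (k : R * M) := tens p e k.1 (f k.2).
have [|F FE] := @quot_lift R _ (@frob_relations p R M e) _ (malg_ext h).
  move=> z [[[[a [b [x ->]]]|[a [x [y ->]]]]|[r [a [x ->]]]]|[r [a [x ->]]]];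
    rewrite !linearB ?linearZ /= !malg_extU /h /=.
  - by rewrite tensDl addrAC addrK subrr.
  - by rewrite linearD tensDr addrAC addrK subrr.
  - by rewrite tensZl scalerN subrr.
  - by rewrite linearZ tensZr subrr.
by exists F => a x; rewrite [in LHS]/tens FE /= malg_extU.
Qed.

End Tensor.

(** * Tight closure of the zero submodule *)

Section TightClosure.
Variables (p : nat) (R : comNzRingType).

Lemma Rcirc1 : Rcirc R 1.
Proof.
move=> [P [[Pideal PT _] _] P1]; apply: PT; apply/seteqP; split=> // x _.
by rewrite -[x]mulr1; exact: (@submoduleZ R R^o P x 1).
Qed.

Lemma RcircM c d : Rcirc R c -> Rcirc R d -> Rcirc R (c * d).
Proof.
move=> Rc Rd [P Pmin]; have [[_ _ PM] _] := Pmin.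
by case/PM => [Pc|Pd]; [apply: Rc|apply: Rd]; exists P.
Qed.

Section Zero.
Variable M : lmodType R.
Implicit Types (u v : M).

(** Scaling is harmless because $c \otimes r v = r^q (c \otimes v)$ with $q = p^e$. *)
Lemma submodule_tens_eq0 e (c : R) : submodule [set v : M | tens p e c v = 0].
Proof.
split=> /= [|a u v cu cv]; first exact: tens0r.
by rewrite tensDr tensZr mulrC tensZl cu cv scaler0 addr0.
Qed.

Lemma frob_power0 e (z : frobF p M e) : frob_power [set 0] z <-> z = 0.
Proof.
split=> [|->]; last exact: (proj1 (gen_submodule _)).
apply: (gen_sub (N := [set 0])) => [|_ [a [_ [-> ->]]]]; last exact: tens0r.
by split=> // a _ _ -> ->; rewrite scaler0 addr0.
Qed.

Lemma tight_closure0P u : tight_closure p [set 0] u <->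
  exists2 c, Rcirc R c & exists e0, forall e, (e0 <= e)%N -> tens p e c u = 0.
Proof.
by split=> -[c Rc [e0 ce]]; exists c => //; exists e0 => e /ce /frob_power0.
Qed.

(** The product of the multipliers and the maximum of the thresholds serve all elements of the list
    at once. *)
Lemma tight_closure0_uniform (s : seq M) :
  (forall u, u \in s -> tight_closure p [set 0] u) ->
  exists2 c, Rcirc R c & exists e0, forall e, (e0 <= e)%N ->
    forall u, u \in s -> tens p e c u = 0.
Proof.
elim: s => [|u s IH] su; first by exists 1; [exact: Rcirc1|exists 0%N].
have [|c Rc [e0 ce]] := IH; first by move=> v vs; apply: su; rewrite inE vs orbT.
have [|d Rd [e1 de]] := (tight_closure0P u).1; first by apply: su; rewrite inE eqxx.
exists (c * d); first exact: RcircM.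
exists (maxn e0 e1) => e; rewrite geq_max => /andP[e0e e1e] v.
rewrite inE => /predU1P[->|vs]; first by rewrite tensZl de ?scaler0.
by rewrite mulrC tensZl ce ?scaler0.
Qed.

Lemma submodule_tight_closure0 : submodule (@tight_closure p R M [set 0]).
Proof.
split=> [|a u v u0 v0].
  by apply/tight_closure0P; exists 1; [exact: Rcirc1|exists 0%N => e _; exact: tens0r].
have [|c Rc [e0 ce]] := @tight_closure0_uniform [:: u; v].
  by move=> w; rewrite !inE => /orP[] /eqP ->.
apply/tight_closure0P; exists c => //; exists e0 => e /ce ceq.
by apply: (proj2 (submodule_tens_eq0 e c)); apply: ceq; rewrite !inE eqxx ?orbT.
Qed.

End Zero.

Lemma tight_closure0_linear (M T : lmodType R) (f : {linear M -> T}) u :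
  tight_closure p [set 0] u -> tight_closure p [set 0] (f u).
Proof.
move=> /tight_closure0P[c Rc [e0 ce]]; apply/tight_closure0P; exists c => //.
exists e0 => e /ce cu; have [F FE] := frob_functor p e f.
by rewrite -FE cu linear0.
Qed.

Lemma sub_tight_closure (M : lmodType R) (N : set M) :
  N `<=` tight_closure p N.
Proof.
move=> u Nu; exists 1; first exact: Rcirc1.
by exists 0%N => e _; apply: sub_gen; exists 1, u.
Qed.

Lemma scale_linear (M : lmodType R) (z : M) : exists f : {linear R^o -> M},
  forall r : R, f r = r *: z.
Proof.
apply: (@linear_bundle R R^o M (fun r => r *: z)) => a x y.
by rewrite scalerDl scalerA.
Qed.

(** Apply $F^e$ to $r \mapsto r z$: it carries $c \otimes x \in I^{[q]}$ to $c \otimes x z$. One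
    multiplier [d] works for the finitely many generators of [I], hence annihilates the image of
    $I^{[q]}$. *)
Lemma tight_closure_scale (I : set R) (M : lmodType R) (x : R) (z : M) :
  @finitely_generated R R^o I ->
  (forall y, I y -> tight_closure p [set 0] (y *: z)) ->
  @tight_closure p R R^o I x -> tight_closure p [set 0] (x *: z).
Proof.
move=> [s Is] Iz [c Rc [e0 ce]]; have [f fE] := scale_linear z.
have [|d Rd [e1 de]] := @tight_closure0_uniform M [seq y *: z | y <- s].
  by move=> _ /mapP[y ys ->]; apply: Iz; rewrite Is; exact: sub_gen.
apply/tight_closure0P; exists (d * c); first exact: RcircM.
exists (maxn e0 e1) => e; rewrite geq_max => /andP[/ce e0e /de e1e].
have [F FE] := frob_functor p e f.
have IK y : I y -> tens p e d (f y) = 0.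
  rewrite Is => sy.
  have fK := submodule_preimage f (submodule_tens_eq0 M e d).
  apply: (gen_sub fK _ sy) => {sy}y ys /=.
  by rewrite fE; apply: e1e; exact: map_f.
rewrite tensZl -fE -FE.
have dF : submodule [set w : frobF p R^o e | d *: F w = 0].
  split=> /= [|a u v u0 v0]; first by rewrite linear0 scaler0.
  by rewrite linearP scalerDr v0 addr0 scalerA mulrC -scalerA u0 scaler0.
apply: (gen_sub dF _ e0e) => _ [a [y [Iy ->]]] /=.
by rewrite FE -tensZl mulrC tensZl IK // scaler0.
Qed.

End TightClosure.

(** * The parameter test module *)

Section HomModule.
Variable R : comNzRingType.
Variables H E : lmodType R.

(** Linear maps already form a submodule, so the generated submodule in [hom_module] contains no
    other function. *)
Lemma hom_eval_linear (f : hom_module H E) : linear (hom_eval f).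
Proof.
have lin : submodule [set g : H -> E | linear g].
  split=> [|a g h gL hL b x y]; first by move=> a x y; rewrite scaler0 addr0.
  rewrite /= !fctE gL hL !scalerDr !scalerA mulrC addrACA.
  by congr (_ + _); rewrite mulrC.
have := valP f; rewrite /hom_eval => /asboolP.
by rewrite gen_id.
Qed.

Lemma hom_bundle (g : {linear H -> E}) :
  exists f : hom_module H E, forall z, hom_eval f z = g z.
Proof.
have gP : gen_pred [set f : H -> E | linear f] g.
  by apply/asboolP; apply: sub_gen => a x y; exact: linearP.
by exists (exist _ (g : H -> E) gP).
Qed.

Lemma hom_evalZ a (f : hom_module H E) z : hom_eval (a *: f) z = a *: hom_eval f z.
Proof. by []. Qed.

Lemma hom_eval_sum n (f : 'I_n -> hom_module H E) z :
  hom_eval (\sum_i f i) z = \sum_i hom_eval (f i) z.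
Proof.
by elim/big_rec2 : _ => [|i y x _ <-].
Qed.

End HomModule.

Lemma strong_test_parameter_module (p : nat) (R : comNzRingType)
    (R_noeth : noetherian R) (H E : lmodType R) (E_inj : injective_module E)
    (I : set R) :
  ideal I ->
  @smul R (hom_module H E) (@tight_closure p R R^o I)
    (@parameter_test_module R p H E) =
  @smul R (hom_module H E) I (@parameter_test_module R p H E).
Proof.
move=> Iideal; set tau := @parameter_test_module R p H E; have Ifg := R_noeth _ Iideal.
apply/seteqP; split; last first.
  apply: gen_mono => _ [a [t [Ia taut ->]]]; exists a, t; split=> //.
  exact: sub_tight_closure.
apply: gen_sub => [|_ [x [t [Ix taut ->]]]]; first exact: gen_submodule.
pose N : set H := tight_closure p [set 0].
have NM : submodule N by exact: submodule_tight_closure0.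
have [s Is] := Ifg; pose n := size s.
pose phi (z : H) : {ffun 'I_n -> quotmod N} :=
  [ffun i : 'I_n => quot_proj N ((s`_i : R) *: z)].
have phiL : linear phi.
  move=> a y z; apply/ffunP => i; rewrite !ffunE -linearP.
  by rewrite scalerDr !scalerA mulrC.
have [Phi PhiE] := linear_bundle phiL.
pose Z := [set z | Phi z = 0].
(* On the kernel of [Phi] every generator of [I] multiplies [z] into [N], hence so does all of
   [I]. *)
have PhiZ z : Phi z = 0 -> N (x *: z).
  move=> z0; apply: tight_closure_scale Ix => // y Iy.
  have [f fE] := scale_linear z.
  have NK := submodule_preimage f NM.
  rewrite -fE; move: Iy; rewrite Is; apply: (gen_sub NK) => y' /= ys'.
  rewrite fE -(nth_index 0 ys') -/N.
  have i_lt : (index y' s < n)%N by rewrite index_mem.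
  move: z0; rewrite PhiE => /ffunP/(_ (Ordinal i_lt)); rewrite !ffunE /=.
  by move=> /quot_proj_eq0; rewrite gen_id.
(* Factoring out the kernel turns [Phi] into an injection [i], along which maps to [E] extend. *)
have [i iE] := quot_lift (fun z (Zz : Z z) => Zz : Phi z = 0).
have i_inj : injective i.
  move=> u v; have [u' ->] := quot_projP u; have [v' ->] := quot_projP v.
  rewrite !iE => uv; apply/quot_projE; apply: sub_gen.
  by rewrite /Z /= linearB uv subrr.
have xtL : linear (fun z => x *: hom_eval t z).
  by move=> a y z; rewrite hom_eval_linear scalerDr !scalerA mulrC.
have [xt xtE] := linear_bundle xtL.
have [z /PhiZ Nz|j jE] := @quot_lift R H Z _ xt.
  have [T TE] := linear_bundle (hom_eval_linear t).
  by rewrite xtE -TE -linearZ TE; exact: taut.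
have [h hE] := E_inj _ _ i j i_inj.
(* [d k] is reduction modulo [N] followed by the [k]-th coordinate inclusion; composed with [h] it
   gives $t_k$, which therefore kills [N]. *)
pose d (k : 'I_n) (z : H) : {ffun 'I_n -> quotmod N} :=
  [ffun l : 'I_n => if l == k then quot_proj N z else 0].
have dL k : linear (d k).
  move=> a y z; apply/ffunP => l; rewrite !ffunE linearP.
  by case: (l == k) => //; rewrite scaler0 addr0.
have hdL k : linear (h \o d k) by move=> a y z; rewrite /= dL linearP.
have /choice[tk tkE] k : exists f : hom_module H E, forall z, hom_eval f z = h (d k z).
  have [g gE] := linear_bundle (hdL k); have [f fE] := hom_bundle g.
  by exists f => z; rewrite fE gE.
(* Apply [h] to $\Phi(z) = \sum_k s_k d_k(z)$. *)
have -> : x *: t = \sum_(k < n) (s`_k : R) *: tk k.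
  apply: val_inj; apply/funext => z.
  rewrite -[LHS]/(x *: hom_eval t z).
  rewrite -[RHS]/(hom_eval (\sum_(k < n) (s`_k : R) *: tk k) z).
  rewrite hom_eval_sum -xtE -jE -hE iE PhiE.
  under eq_bigr do rewrite hom_evalZ tkE -linearZ.
  rewrite -linear_sum; congr (h _); apply/ffunP => l; rewrite ffunE sum_ffunE.
  rewrite (bigD1 l) //= !ffunE eqxx big1 ?addr0; first by rewrite linearZ.
  by move=> k /negPf kl; rewrite !ffunE eq_sym kl scaler0.
apply: submodule_sum => [|k _]; first exact: gen_submodule.
apply: sub_gen; exists s`_k, (tk k); split=> //.
  by rewrite Is; apply: sub_gen; exact: mem_nth.
move=> z Nz; rewrite tkE; have -> : d k z = 0; last exact: linear0.
apply/ffunP => l; rewrite !ffunE; case: eqP => // _.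
by apply/quot_proj_eq0; exact: sub_gen.
Qed.

(** * Noetherian local rings: the theorems of Krull and Chevalley *)

Lemma exists_maximal_avoiding (R : comNzRingType) (M : lmodType R) (A : set M) (w : M) :
  submodule A -> ~ A w ->
  exists L : set M, [/\ submodule L, A `<=` L, ~ L w &
    forall L', submodule L' -> L `<=` L' -> ~ L' w -> L' = L].
Proof.
(* The union of the empty chain is empty, which is not a submodule; the predicate therefore concerns
   the union of [A] with [X]. *)
move=> AM Aw; pose P X := submodule (A `|` X) /\ ~ (A `|` X) w.
have [F FP Ftot|X [[XM Xw] Xmax]] := @Zorn_bigcup M P.
  have common x y : (A `|` \bigcup_(X in F) X) x -> (A `|` \bigcup_(X in F) X) y ->
      exists B, [/\ submodule B, B `<=` A `|` \bigcup_(X in F) X, B x & B y].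
    have sub X : F X -> A `|` X `<=` A `|` \bigcup_(X in F) X.
      by move=> FX; apply: setUS; exact: bigcup_sup.
    have subM X : F X -> submodule (A `|` X) by move=> /FP[].
    move=> [Ax|[X FX Xx]] [Ay|[Y FY Yy]].
    - by exists A; split=> // z Az; left.
    - by exists (A `|` Y); split; [exact: subM|exact: sub|left|right].
    - by exists (A `|` X); split; [exact: subM|exact: sub|right|left].
    - have [XY|YX] := Ftot _ _ FX FY.
      + by exists (A `|` Y); split; [exact: subM|exact: sub|right; exact: XY|right].
      + by exists (A `|` X); split; [exact: subM|exact: sub|right|right; exact: YX].
  split.
    split=> [|a x y xF yF]; first by left; case: AM.
    have [B [BM Bsub Bx By]] := common _ _ xF yF.
    by apply: Bsub; exact: (proj2 BM).
  by move=> [//|[X /FP[_ +] Xw]]; apply; right.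
exists (A `|` X); split=> //.
move=> L' L'M XL' L'w; have AL' : A `|` L' = L'.
  by apply/setUidPr => x Ax; apply: XL'; left.
have [L'X|L'X] := pselect (L' `<=` A `|` X); first by apply/seteqP; split.
case: (Xmax L'); last by rewrite /P AL'.
split=> [x Xx|L'X']; first by apply: XL'; right.
by apply: L'X => x /L'X'; right.
Qed.

Section LocalNoetherian.
Variables (R : comNzRingType) (m : set R).
Hypothesis R_noeth : noetherian R.
Hypothesis R_local : local_ring m.
Implicit Types (A J L : set R) (a b w x : R).

Lemma ideal0 A : ideal A -> A 0. Proof. by case. Qed.

Lemma idealM A a x : ideal A -> A x -> A (a * x).
Proof. exact: submoduleZ. Qed.

Lemma idealD A x y : ideal A -> A x -> A y -> A (x + y).
Proof. exact: submoduleD. Qed.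

Lemma idealB A x y : ideal A -> A x -> A y -> A (x - y).
Proof. exact: submoduleB. Qed.

Lemma ideal_setT : ideal (@setT R).
Proof. by split. Qed.

Lemma maximal_ideal_local : maximal_ideal m.
Proof. exact/R_local. Qed.

Lemma ideal_local : ideal m.
Proof. by case: maximal_ideal_local. Qed.

(** If [a] is not a unit, an ideal maximal among those containing [a] but not 1 is a maximal ideal,
    hence equals [m]. *)
Lemma local_unit a : ~ m a -> exists b, b * a = 1.
Proof.
move=> ma; have aM : ideal [set x | exists b, x = b * a].
  split=> [|c _ _ [b ->] [b' ->]]; first by exists 0; rewrite mul0r.
  by exists (c * b + b'); rewrite mulrDl -mulrA.
have [[b b1]|a1] := pselect ([set x | exists b, x = b * a] 1); first by exists b.
have [L [LM aL L1 Lmax]] := exists_maximal_avoiding aM a1.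
have : maximal_ideal L.
  split=> // [LT|J JM LJ]; first by apply: L1; rewrite LT.
  have [J1|J1] := pselect (J 1); [right|by left; exact: Lmax].
  by apply/seteqP; split=> // x _; rewrite -[x]mulr1; exact: idealM.
by move=> /R_local Lm; case: ma; rewrite -Lm; apply: aL; exists 1; rewrite mul1r.
Qed.

Lemma local_sub1 a : m a -> exists b, b * (1 - a) = 1.
Proof.
move=> ma; apply: local_unit => ma1; have [mM mT _] := maximal_ideal_local.
apply: mT; apply/seteqP; split=> // x _; rewrite -[x]mulr1 -[1](subrK a).
by apply/(idealM _ mM)/(idealD mM).
Qed.

(** The union of the chain is an ideal, and its finitely many generators all lie in one [K n]. *)
Lemma noetherian_acc (K : nat -> set R) :
  (forall n, ideal (K n)) -> (forall n, K n `<=` K n.+1) ->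
  exists n, K n.+1 `<=` K n.
Proof.
move=> KM KS; have Kle i j : (i <= j)%N -> K i `<=` K j.
  by move=> /subnK <-; elim: (j - i)%N => // k IH x /IH; exact: KS.
have UM : ideal (\bigcup_n K n).
  split=> [|a x y [i _ Kx] [j _ Ky]]; first by exists 0%N => //; exact: ideal0.
  exists (maxn i j) => //; apply: (proj2 (KM _)).
    exact: Kle (leq_maxl _ _) _ Kx.
  exact: Kle (leq_maxr _ _) _ Ky.
have [s Us] := R_noeth UM.
have [n sn] : exists n, [set` s] `<=` K n.
  have : [set` s] `<=` \bigcup_n K n by rewrite Us; exact: sub_gen.
  elim: s {Us} => [|x s IH] sU; first by exists 0%N.
  have [|n sn] := IH; first by move=> y /= ys; apply: sU; rewrite /= inE ys orbT.
  have [|k _ xk] := sU x; first by rewrite /= inE eqxx.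
  exists (maxn n k) => y /=; rewrite inE => /predU1P[->|ys].
    exact: Kle (leq_maxr _ _) _ xk.
  exact: Kle (leq_maxl _ _) _ (sn _ ys).
exists n => x Kx; apply: (gen_sub (KM n) sn); rewrite -Us.
by exists n.+1.
Qed.

(** Every ideal strictly containing [L] contains [w]. This first forces $a w$ into [L]; stationarity
    of the chain of colon ideals $L : a^k$ then yields the power. *)
Lemma maximal_avoiding_pow L w a : ideal L -> ~ L w ->
  (forall L', ideal L' -> L `<=` L' -> ~ L' w -> L' = L) ->
  m a -> exists k, L (a ^+ k).
Proof.
move=> LM Lw Lmax ma.
have Ladd y : ~ L y -> exists n c, L n /\ w = n + c * y.
  move=> Ly; apply: contrapT => yw; apply: Ly.
  have yM := @submodule_setU1 R R^o L y LM.
  rewrite -(Lmax _ yM).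
  - by exists 0, 1; rewrite add0r scale1r; split => //; exact: ideal0.
  - by move=> x Lx; exists x, 0; rewrite scale0r addr0.
  - exact: yw.
have Law : L (a * w).
  (* Otherwise $w = n + c a w$ with $n \in L$; as $1 - c a$ is a unit, $w$ would lie in [L]. *)
  apply: contrapT => /Ladd[n [c [Ln wE]]]; apply: Lw.
  have [b b1] : exists b, b * (1 - c * a) = 1.
    by apply: local_sub1; exact: idealM ideal_local _.
  rewrite -[w]mul1r -b1 -mulrA; apply: idealM => //.
  by rewrite mulrBl mul1r -mulrA {1}wE addrK.
have [||n Kn] := @noetherian_acc (fun k => [set b | L (b * a ^+ k)]).
- move=> k; split=> /= [|c x y Lx Ly]; first by rewrite mul0r; exact: ideal0.
  by rewrite mulrDl -mulrA; exact: (proj2 LM).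
- by move=> k b /= Lb; rewrite exprS mulrCA; exact: idealM.
(* If $a^n \notin L$, write $w = l + c a^n$ with $l \in L$. Then $a w \in L$ gives $c a^{n+1} \in
   L$, so $c a^n \in L$ by stationarity, and $w \in L$. *)
exists n; apply: contrapT => /Ladd[l [c [Ll wE]]]; apply: Lw.
rewrite wE; apply: idealD => //; apply: Kn => /=.
rewrite exprS mulrCA; have -> : a * (c * a ^+ n) = a * w - a * l.
  by rewrite wE mulrDr addrAC subrr add0r.
by apply: idealB => //; exact: idealM.
Qed.

Lemma ideal_exp_ideal n : ideal (ideal_exp m n).
Proof. by case: n => [|n]; [exact: ideal_setT|exact: gen_submodule]. Qed.

Lemma ideal_expS_sub n : ideal_exp m n.+1 `<=` ideal_exp m n.
Proof.
apply: (gen_sub (ideal_exp_ideal n)) => _ [a [x [_ nx ->]]].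
exact: idealM (ideal_exp_ideal n) nx.
Qed.

Lemma ideal_exp_le i j : (i <= j)%N -> ideal_exp m j `<=` ideal_exp m i.
Proof.
by move=> /subnK <-; elim: (j - i)%N => // k IH x /ideal_expS_sub; exact: IH.
Qed.

(** The extra factor [b] lets the induction on [n] peel off one generator at a time, each time by a
    reduction to generators inside a colon ideal. *)
Lemma ideal_exp_prod (s : seq R) L n b : m = @gen R R^o [set` s] -> ideal L ->
  (forall t : seq R, size t = n -> {subset t <= s} -> L (\prod_(x <- t) x * b)) ->
  forall x, ideal_exp m n x -> L (x * b).
Proof.
move=> ms LM; elim: n b => [|n IH] b Lt x.
  move=> _; apply: idealM => //.
  by have := Lt [::] erefl; rewrite big_nil mul1r; apply.
have colon y : ideal [set z | L (z * y)].
  split=> /= [|c u v Lu Lv]; first by rewrite mul0r; exact: ideal0.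
  by rewrite mulrDl -mulrA; exact: (proj2 LM).
apply: (gen_sub (colon b)) => _ [a [y [ma ny ->]]] /=.
rewrite /GRing.scale /= -mulrA; move: ma; rewrite ms.
apply: (gen_sub (colon (y * b))) => {}a /= sa.
rewrite mulrCA; apply: IH ny => t tn ts.
rewrite mulrCA mulrA; have := Lt (a :: t); rewrite big_cons /= tn; apply=> //.
by move=> z; rewrite inE => /predU1P[->|/ts].
Qed.

(** Pigeonhole: a long enough product of generators contains one of them to a power that lies in
    [L]. *)
Lemma ideal_exp_sub (s : seq R) L : m = @gen R R^o [set` s] -> ideal L ->
  (forall x, x \in s -> exists k, L (x ^+ k)) -> exists n, ideal_exp m n `<=` L.
Proof.
move=> ms LM sL.
suff [n nt] : exists n, forall t : seq R, (n <= size t)%N -> {subset t <= s} ->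
    L (\prod_(x <- t) x).
  exists n => x nx; rewrite -[x]mulr1; apply: (ideal_exp_prod ms LM _ nx) => t tn ts.
  by rewrite mulr1; apply: nt => //; rewrite tn.
elim: s sL {ms} => [|y s IH] sL.
  (* The bound is 1, as the empty product may lie outside [L] while no nonempty list has its entries
     in the empty one. *)
  by exists 1%N => -[//|y t] _ /(_ y (mem_head _ _)).
have [|n nt] := IH; first by move=> x xs; apply: sL; rewrite inE xs orbT.
have [|k yk] := sL y; first by rewrite inE eqxx.
(* Either [y] occurs at least [k] times, or more than [n] factors come from the rest of the list. *)
exists (n + k)%N => t nkt ts.
rewrite (bigID (pred1 y)) /=.
have [kt|tk] := leqP k (count_mem y t).
  rewrite mulrC; apply: idealM => //.
  rewrite (eq_bigr (fun=> y)) => [|z /eqP //].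
  by rewrite big_const_seq iter_mulr_1 -(subnK kt) exprD; exact: idealM.
apply: idealM => //; rewrite -big_filter; apply: nt.
  rewrite size_filter -(leq_add2r k) (leq_trans nkt) //.
  by rewrite -(count_predC (pred1 y) t) addnC leq_add2l ltnW.
move=> z; rewrite mem_filter => /andP[zy /ts].
by rewrite inE (negPf zy).
Qed.

Definition ideal_add A J : set R := [set x | exists2 a, A a & J (x - a)].

(** If $x \notin A$, an ideal [L] containing [A] and maximal without [x] contains a power of each
    generator of [m], hence some $m^n$; but then $x \in A + m^n \subseteq L$. *)
Lemma krull_intersection A x : ideal A ->
  (forall n, ideal_add A (ideal_exp m n) x) -> A x.
Proof.
move=> AM Ax; apply: contrapT => xA.
have [L [LM AL Lx Lmax]] := exists_maximal_avoiding AM xA.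
have [s ms] := R_noeth ideal_local.
have [y ys|n nL] := ideal_exp_sub ms LM.
  by apply: maximal_avoiding_pow LM Lx Lmax _; rewrite ms; exact: sub_gen.
have [a Aa /nL Lxa] := Ax n; apply: Lx; rewrite -(subrK a x).
by apply: idealD => //; exact: AL.
Qed.

Section Directed.
Variable F : set (set R).
Hypothesis F_ideal : forall A, F A -> ideal A.
Hypothesis F_neq0 : exists A, F A.
Hypothesis F_dir : forall A B, F A -> F B -> exists C, [/\ F C, C `<=` A & C `<=` B].

(** Some member of the family has the least image in $R/J$: the descending chain condition in a form
    suited to directed families. *)
Definition stable_mod J := exists2 A0, F A0 & forall A, F A -> A0 `<=` ideal_add A J.

(** Modulo [J'] the multiples of [g] form a space of dimension at most one over $R/m$. Either every
    member of the family contains [g] modulo [J'], or some member does not, and then neither does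
    any smaller one. *)
Lemma stable_mod_step J J' g : ideal J' ->
  (forall x, J x -> exists n c, J' n /\ x = n + c * g) ->
  (forall a, m a -> J' (a * g)) -> stable_mod J -> stable_mod J'.
Proof.
move=> J'M JE mg [A0 FA0 A0J].
have [gall|] := pselect (forall A, F A -> ideal_add A J' g).
  exists A0 => // A FA x /(A0J _ FA)[a Aa /JE[n [c [J'n xE]]]].
  have [b Ab J'gb] := gall _ FA.
  exists (a + c * b).
    by apply: idealD (F_ideal FA) _ _ => //; exact: idealM (F_ideal FA) _.
  rewrite opprD addrA xE -addrA -mulrBr; apply: idealD => //; exact: idealM.
move=> /existsNP[A1 /not_implyP[FA1 gA1]].
have [A2 [FA2 A20 A21]] := F_dir FA0 FA1; exists A2 => // A FA x A2x.
have [A3 [FA3 A3A A32]] := F_dir FA FA2.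
have [a A3a /JE[n [c [J'n xE]]]] := A0J _ FA3 _ (A20 _ A2x).
exists a; first exact: A3A.
rewrite xE; apply: idealD => //; apply: mg.
(* If [c] were a unit, [g] would lie in $A_1 + J'$. *)
apply: contrapT => /local_unit[b bc]; apply: gA1.
have A1M := F_ideal FA1.
exists (b * (x - a)).
  by apply/(idealM _ A1M)/(idealB A1M); apply: A21 => //; exact: A32.
rewrite xE mulrDr mulrA bc mul1r opprD addrCA subrr addr0 -mulrN.
by apply: idealM => //; rewrite -sub0r; apply: idealB => //; exact: ideal0.
Qed.

(** Intermediate ideals, each generated over the next by one element of [s], reduce this to
    [stable_mod_step]. *)
Lemma stable_mod_seq (s : seq R) J J' : ideal J' ->
  J `<=` @gen R R^o (J' `|` [set` s]) ->
  (forall a g, m a -> g \in s -> J' (a * g)) -> stable_mod J -> stable_mod J'.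
Proof.
elim: s J' => [|g s IH] J' J'M Js mg Jst.
  have [A0 FA0 A0J] := Jst; exists A0 => // A FA x /(A0J _ FA)[a Aa Jxa].
  exists a => //; apply: (gen_sub J'M _ (Js _ Jxa)).
  by move=> y [].
apply: (@stable_mod_step (@gen R R^o (J' `|` [set g])) _ g) => //.
- by move=> x /gen_setU1; rewrite gen_id.
- by move=> a ma; apply: mg => //; rewrite inE eqxx.
apply: IH => //; first exact: gen_submodule.
  apply: (subset_trans Js); apply: (@gen_mono R R^o) => y [J'y|/=].
    by left; apply: sub_gen; left.
  by rewrite inE => /predU1P[->|ys]; [left; apply: sub_gen; right|right].
by move=> a g' ma g's; apply: sub_gen; left; apply: mg => //; rewrite inE g's orbT.
Qed.

(** $m^n/m^{n+1}$ is generated by finitely many elements, all killed by [m]. *)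
Lemma stable_mod_exp n : stable_mod (ideal_exp m n).
Proof.
elim: n => [|n IH].
  by have [A FA] := F_neq0; exists A => // B /F_ideal/ideal0 B0 x _; exists 0.
have [s ns] := R_noeth (ideal_exp_ideal n).
apply: (@stable_mod_seq s (ideal_exp m n)) => //.
- exact: ideal_exp_ideal.
- by rewrite [X in X `<=` _]ns; apply: (@gen_mono R R^o) => y ys; right.
move=> a g ma gs; apply: sub_gen; exists a, g; split => //.
by rewrite -[_ g]/(ideal_exp m n g) ns; exact: sub_gen.
Qed.

(* Chevalley's theorem, for a directed family instead of a descending sequence. *)
Lemma directed_sub_exp (R_complete : adically_complete m) n :
  exists2 A, F A & A `<=` ideal_add (\bigcap_(B in F) B) (ideal_exp m n).
Proof.
have /choice[A AP] k : exists A,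
    F A /\ forall B, F B -> A `<=` ideal_add B (ideal_exp m k).
  by have [A FA AB] := stable_mod_exp k; exists A.
exists (A n) => [|x Anx]; first exact: (AP n).1.
(* An element of [A k] is corrected modulo $m^k$ to an element of [A k.+1]; outside [A k] the value
   0 is a mere default. *)
have /choice[next nextP] (ky : nat * R) : exists z,
    A ky.1 ky.2 -> A ky.1.+1 z /\ ideal_exp m ky.1 (ky.2 - z).
  have [kyA|//] := pselect (A ky.1 ky.2); last by exists 0.
  by have [z Az zm] := (AP ky.1).2 _ (AP ky.1.+1).1 _ kyA; exists z.
pose b := fix b k := if k is k'.+1 then next ((n + k')%N, b k') else x.
have bA k : A (n + k)%N (b k).
  elim: k => [|k IH]; first by rewrite addn0.
  by rewrite addnS; have [] := nextP ((n + k)%N, b k) IH.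
have bS k : ideal_exp m (n + k)%N (b k.+1 - b k).
  rewrite -opprB -sub0r; have eM := ideal_exp_ideal (n + k).
  apply: idealB => //; first exact: ideal0.
  by have [] := nextP ((n + k)%N, b k) (bA k).
(* Completeness asks for a sequence indexed from 0; truncated subtraction keeps it constant at [x]
   up to index [n]. *)
have [|l lP] := R_complete.2 (fun j => b (j - n)%N).
  move=> j; have [nj|jn] := leqP n j.
    by have := bS (j - n)%N; rewrite subnKC // subSn.
  move: (jn); rewrite -subn_eq0 => /eqP ->; rewrite (eqP (ltnW jn : _ - _ == 0)%N).
  by rewrite subrr; exact: ideal0 (ideal_exp_ideal j).
exists l; last first.
  rewrite -opprB -sub0r; have eM := ideal_exp_ideal n.
  by apply: idealB => //; [exact: ideal0|have := lP n; rewrite subnn].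
(* Modulo $m^{j'}$ the limit agrees with an element of [A j'], which lies in $B + m^{j'}$; Krull's
   theorem then puts the limit in [B]. *)
move=> B FB; apply: krull_intersection => [|j]; first exact: F_ideal.
pose j' := maxn n j; have nj' : (n <= j')%N := leq_maxl _ _.
have jj' : (j <= j')%N := leq_maxr _ _.
have := bA (j' - n)%N; rewrite subnKC // => /((AP j').2 _ FB)[c Bc cm].
exists c => //; apply: (ideal_exp_le jj').
rewrite -(subrK (b (j' - n)%N) l) -addrA; apply: idealD => //.
exact: ideal_exp_ideal.
Qed.

End Directed.
End LocalNoetherian.

(** * The test ideal *)

Section FinitelyGenerated.
Variable R : comNzRingType.
Implicit Types M N T : lmodType R.

Lemma gen_image M T (f : {linear M -> T}) (S : set M) (S' : set T) x :
  (forall y, S y -> S' (f y)) -> gen S x -> gen S' (f x).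
Proof.
move=> SS'; have S'M := submodule_preimage f (gen_submodule S').
by apply: (gen_sub S'M) => y /SS'; exact: sub_gen.
Qed.

Lemma fg_regular : @finitely_generated R R^o setT.
Proof.
exists [:: 1]; apply/esym/seteqP; split=> // x _; rewrite -[x]mulr1.
apply: (@submoduleZ R R^o _ x 1 (gen_submodule _)).
by apply: sub_gen; rewrite /= inE.
Qed.

Lemma fg_family n M T (f : 'I_n -> {linear M -> T}) :
  (forall t, exists x : 'I_n -> M, t = \sum_i f i (x i)) ->
  finitely_generated [set: M] -> finitely_generated [set: T].
Proof.
move=> fT [s sM]; exists [seq f i x | i <- enum 'I_n, x <- s].
apply/esym/seteqP; split=> // t _; have [x ->] := fT t.
apply: submodule_sum => [|i _]; first exact: gen_submodule.
have : gen [set` s] (x i) by rewrite -sM.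
apply: gen_image => y ys; apply/allpairsP; exists (i, y).
by rewrite mem_enum.
Qed.

(** Stated for jointly surjective maps, so that it covers quotients of direct sums as well as direct
    sums. *)
Lemma fg_join M N T (f : {linear M -> T}) (g : {linear N -> T}) :
  (forall t, exists x y, t = f x + g y) ->
  finitely_generated [set: M] -> finitely_generated [set: N] ->
  finitely_generated [set: T].
Proof.
move=> fgT [s sM] [s' sN]; exists (map f s ++ map g s').
apply/esym/seteqP; split=> // t _; have [x [y ->]] := fgT t.
have : gen [set` s] x by rewrite -sM.
have : gen [set` s'] y by rewrite -sN.
move=> s'y sx; apply: (submoduleD (gen_submodule _)).
- by apply: gen_image sx => z /= zs; rewrite mem_cat map_f.
- by apply: gen_image s'y => z /= zs; rewrite mem_cat orbC map_f.
Qed.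

Lemma inl_linear M N : exists f : {linear M -> (M * N)%type}, forall x, f x = (x, 0).
Proof.
apply: (@linear_bundle R M (M * N)%type (fun x => (x, 0))) => a x y.
by congr pair; rewrite /= scaler0 addr0.
Qed.

Lemma inr_linear M N : exists f : {linear N -> (M * N)%type}, forall x, f x = (0, x).
Proof.
apply: (@linear_bundle R N (M * N)%type (fun x => (0, x))) => a x y.
by congr pair; rewrite /= scaler0 addr0.
Qed.

Definition ffun_inj n M (i : 'I_n) (x : M) : {ffun 'I_n -> M} :=
  [ffun j => if j == i then x else 0].

Lemma ffun_inj_linear n M (i : 'I_n) : linear (@ffun_inj n M i).
Proof.
move=> a x y; apply/ffunP => j; rewrite !ffunE.
by case: eqP => // _; rewrite scaler0 addr0.
Qed.

HB.instance Definition _ n M i :=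
  GRing.isLinear.Build R M {ffun 'I_n -> M} *:%R (@ffun_inj n M i)
    (@ffun_inj_linear n M i).

Lemma ffun_inj_sum n M (F : {ffun 'I_n -> M}) : F = \sum_i ffun_inj i (F i).
Proof.
apply/ffunP => j; rewrite sum_ffunE (bigD1 j) //= ffunE eqxx big1 ?addr0 //.
by move=> i /negPf ij; rewrite ffunE eq_sym ij.
Qed.

End FinitelyGenerated.

Section TestIdeal.
Variables (p : nat) (R : comNzRingType) (m : set R).
Hypothesis R_noeth : noetherian R.
Hypothesis R_local : local_ring m.
Hypothesis R_complete : adically_complete m.

Definition test_annihilators : set (set R) :=
  [set A | exists (M : lmodType R) (u : M),
     [/\ finitely_generated [set: M], tight_closure p [set 0] u &
         A = [set r | r *: u = 0]]].

Lemma test_idealE : test_ideal p R = \bigcap_(A in test_annihilators) A.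
Proof.
apply/seteqP; split=> [r tr _ [M [u [Mfg u0 ->]]]|r rA M Mfg u u0]; first exact: tr.
by apply: (rA [set r | r *: u = 0]); exists M, u.
Qed.

(** The annihilator of $(u, v)$ is the intersection of those of $u$ and $v$, so direct sums make the
    family directed. *)
Lemma exists_test_annihilator n : exists2 A, test_annihilators A &
  A `<=` ideal_add (test_ideal p R) (ideal_exp m n).
Proof.
rewrite test_idealE; apply: directed_sub_exp => //.
- move=> _ [M [u [_ _ ->]]]; split=> /= [|a x y xu yu]; first exact: scale0r.
  by rewrite scalerDl -scalerA xu yu scaler0 addr0.
- exists [set r | r *: (0 : R^o) = 0], R^o, 0; split=> //; first exact: fg_regular.
  exact: (proj1 (submodule_tight_closure0 p R^o)).
move=> _ _ [M [u [Mfg u0 ->]]] [N [v [Nfg v0 ->]]].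
have [f fE] := inl_linear M N; have [g gE] := inr_linear M N.
exists [set r | r *: (u, v) = 0]; split.
- exists (M * N)%type, (u, v); split=> //.
    apply: (fg_join (f := f) (g := g)) => // -[x y]; exists x, y.
    by rewrite fE gE; congr pair; rewrite /= ?addr0 ?add0r.
  have -> : (u, v) = f u + g v by rewrite fE gE; congr pair; rewrite /= ?addr0 ?add0r.
  apply: (submoduleD (submodule_tight_closure0 _ _)).
    exact: tight_closure0_linear.
  exact: tight_closure0_linear.
- by move=> r [].
- by move=> r [].
Qed.

Lemma strong_test_ideal (I : set R) : ideal I ->
  @smul R R^o (test_ideal p R) (@tight_closure p R R^o I) =
  @smul R R^o (test_ideal p R) I.
Proof.
move=> Iideal; have Ifg := R_noeth Iideal; have [s Is] := Ifg.
apply/seteqP; split; last first.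
  apply: (@gen_mono R R^o) => _ [a [x [ta Ix ->]]]; exists a, x; split=> //.
  exact: (@sub_tight_closure p R R^o I).
apply: (@gen_sub R R^o _ _ (gen_submodule _)) => _ [a [x [ta Ix ->]]].
apply: (krull_intersection R_noeth R_local); first exact: gen_submodule.
move=> n; have [A [M [u [Mfg u0 ->]]] uA] := exists_test_annihilator n.
pose k := size s; pose F := {ffun 'I_k -> M}.
(* Modulo [S] the [i]-th generator of [I], times the class of 1, becomes the copy of [u] in the
   [i]-th summand. *)
pose S : set (R^o * F)%type :=
  [set z | exists i : 'I_k, z = (s`_i, - ffun_inj i u)].
pose P : lmodType R := quotmod S.
have [f fE] := inl_linear R^o F; have [g gE] := inr_linear R^o F.
pose qf : {linear R^o -> P} := quot_proj S \o f.
pose qg : {linear F -> P} := quot_proj S \o g.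
have Pfg : finitely_generated [set: P].
  apply: (fg_join (f := qf) (g := qg)).
  - move=> t; have [[r w] ->] := quot_projP t; exists r, w.
    rewrite /= -quot_projD fE gE; congr quot_proj.
    by congr pair; rewrite /= ?addr0 ?add0r.
  - exact: fg_regular.
  - apply: (fg_family (f := fun i => ffun_inj i : {linear M -> F})) Mfg => w.
    by exists w; exact: ffun_inj_sum.
have sqf (i : 'I_k) : qf s`_i = qg (ffun_inj i u).
  apply/eqP; rewrite -subr_eq0 /= -linearB fE gE; apply/eqP/quot_proj_eq0.
  by apply: sub_gen; exists i; congr pair; rewrite /= ?oppr0 ?addr0 ?sub0r.
have qfZ (r : R) : qf r = r *: (qf 1 : P) by rewrite -linearZ [_ *: _]mulr1.
have Iqf y : I y -> tight_closure p [set 0] (y *: (qf 1 : P)).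
  rewrite -qfZ Is.
  apply: (gen_sub (submodule_preimage qf (submodule_tight_closure0 p P))) => {}y ys /=.
  have i_lt : (index y s < k)%N by rewrite index_mem.
  have := sqf (Ordinal i_lt); rewrite /= nth_index // => ->.
  exact/(tight_closure0_linear qg)/tight_closure0_linear.
have /quot_proj_eq0 : quot_proj S (f (a * x)) = 0.
  rewrite -[LHS]/(qf _) qfZ -scalerA; apply: ta => //.
  exact: tight_closure_scale Ix.
rewrite fE => Sax.
(* Linear combinations of [S] in explicit form, so that membership of $(a x, 0)$ can be read off
   coordinatewise. *)
pose B : set (R^o * F)%type := [set z | exists b : 'I_k -> R,
  z = (\sum_i b i * s`_i, - [ffun i => b i *: u])].
have BM : submodule B.
  split=> [|c _ _ [b ->] [b' ->]].
    exists (fun=> 0); congr pair; first by rewrite big1 // => i _; rewrite mul0r.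
    by apply/ffunP => i; rewrite !ffunE scale0r oppr0.
  exists (fun i => c * b i + b' i); congr pair => /=.
    rewrite scaler_sumr -big_split /=; apply: eq_bigr => i _.
    by rewrite mulrDl -mulrA.
  by apply/ffunP => i; rewrite !ffunE scalerDl -scalerA opprD scalerN.
have [|b [axE bu]] := gen_sub BM _ Sax.
  move=> _ [i ->]; exists (fun j => (j == i)%:R); congr pair.
    rewrite (bigD1 i) //= eqxx mul1r big1 ?addr0 // => j /negPf ->.
    by rewrite mul0r.
  congr (- _); apply/ffunP => j; rewrite !ffunE.
  by case: eqP => _; rewrite ?scale1r ?scale0r.
(* The second coordinate of $(a x, 0)$ vanishes, so each [b i] annihilates [u] and lies in $\tau(R)
   + m^n$. *)
have /choice[t tP] i : exists t, test_ideal p R t /\ ideal_exp m n (b i - t).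
  have [|t tt bt] := uA (b i); last by exists t.
  have /ffunP/(_ i) := bu; rewrite !ffunE /= => /esym/eqP.
  by rewrite oppr_eq0 => /eqP.
(* Replacing each [b i] by [t i] changes the sum by an element of $m^n$ only. *)
exists (\sum_i t i * s`_i).
  apply: (@submodule_sum R R^o) => [|i _]; first exact: gen_submodule.
  apply: sub_gen; exists (t i), s`_i; split=> //; first exact: (tP i).1.
  by rewrite Is; apply: sub_gen; exact: mem_nth.
rewrite -[a *: x]/(a * x) axE -sumrB.
apply: (@submodule_sum R R^o) => [|i _]; first exact: ideal_exp_ideal.
rewrite -mulrBl mulrC; apply: idealM; first exact: ideal_exp_ideal.
exact: (tP i).2.
Qed.

End TestIdeal.

Set Strict Implicit.
Unset Implicit Arguments.
Set Printing Implicit Defensive.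

Theorem corollary2p6 (p : nat) (R : comNzRingType) (m : set R)
    (R_noeth : noetherian R) (R_local : local_ring m)
    (R_complete : adically_complete m) (R_char : p \in [pchar R]) :
  (forall I : set R, ideal I ->
     @smul R R^o (test_ideal p R) (@tight_closure p R R^o I) =
     @smul R R^o (test_ideal p R) I)
  /\
  (integral_domain R ->
   forall (d : nat), cohen_macaulay_of_dim m d ->
   forall (E : injective_hull (residue_field m))
          (J : injective_resolution R^o),
   let H := local_cohomology m J d in
   let tau_par := @parameter_test_module R p H E in
   forall I : set R, ideal I ->
     @smul R (hom_module H E) (@tight_closure p R R^o I) tau_par =
     @smul R (hom_module H E) I tau_par).
Proof.
split=> [I|_ d _ E J H tau_par I]; first exact: strong_test_ideal.
exact/strong_test_parameter_module/hull_injective.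
Qed.
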